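(* Let $S\subset[-1,1]$ be a finite set of $N$ slopes and $\mathcal R\subset\mathcal D_S^2$, with $\mathcal R_s=\mathcal R\cap\mathcal D_s^2$. Suppose that for some $\gamma\ge0$ the maximal operators $\{\mathrm M_{\mathcal R_s}:s\in S\}$ satisfy $$\sup_{s\in S}\big\|\mathrm M_{\mathcal R_s}:L^p(\mathbb R^2)\to L^{p,\infty}(\mathbb R^2)\big\|\lesssim (p')^\gamma,\qquad p\to1^+,$$ i.e. there are $A<\infty$ and $p_0\in(1,2]$ such that the left-hand side is at most $A(p')^\gamma$ for all $1<p\le p_0$. Then for every $L^\infty$-normalized Carleson sequence $a=\{a_R\}_{R\in\mathcal D_S^2}$, $$\mathsf{mass}_{a,2}(\mathcal R)\lesssim(\log N)^{\frac12}\big((1+\gamma)\log\log N\big)^{\frac\gamma2}\,\mathsf{mass}_{a,1}(\mathcal R)^{\frac12},$$ where the implicit constant depends only on $\gamma$, $A$, $p_0$ (and not on $N$, $S$, $\mathcal R$ or $a$).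
   Context: For $s\in\mathbb R$ let $A_s=\begin{pmatrix}1&0\\ s&1\end{pmatrix}$. $\mathcal P_s^2$ is the collection of parallelograms $A_s(I\times J)$ with $I,J$ bounded intervals, $|I|\ge|J|$, and $\mathcal P_S^2=\bigcup_{s\in S}\mathcal P_s^2$. With $\mathcal D$ the standard dyadic grid on $\mathbb R$, let $\mathcal D_0^2=\{I\times J: I,J\in\mathcal D,\ |I|\ge|J|\}$, $\mathcal D_s^2=\{A_sR:R\in\mathcal D_0^2\}$, $\mathcal D_S^2=\bigcup_{s\in S}\mathcal D_s^2$. For a collection $\mathcal R$ of parallelograms, $\mathsf{sh}(\mathcal R)=\bigcup_{R\in\mathcal R}R$ and $\mathrm M_{\mathcal R}f(x)=\sup_{R\in\mathcal R}\langle|f|\rangle_R\mathbf 1_R(x)$, where $\langle g\rangle_R=|R|^{-1}\int_Rg$. A collection $\mathcal L\subset\mathcal P_S^2$ is subordinate to $\mathcal T\subset\mathcal P_\tau^2$ ($\tau\in S$ a single fixed slope) if every $L\in\mathcal L$ is contained in some $T\in\mathcal T$. A sequence $a=\{a_R\}_{R\in\mathcal D_S^2}$ of nonnegative numbers is an $L^\infty$-normalized Carleson sequence if $\sum_{R\in\mathcal D_S^2}a_R<\infty$ and for every $\tau\in S$, every $\mathcal T\subset\mathcal P_\tau^2$ and every $\mathcal L\subset\mathcal D_S^2$ subordinate to $\mathcal T$ one has $\sum_{L\in\mathcal L}a_L\le|\mathsf{sh}(\mathcal T)|$. For $\mathcal R\subset\mathcal D_S^2$ the balayage is $T_{\mathcal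 R}(a)=\sum_{R\in\mathcal R}a_R\frac{\mathbf 1_R}{|R|}$ and $\mathsf{mass}_{a,p}(\mathcal R)=\|T_{\mathcal R}(a)\|_{L^p(\mathbb R^2)}$ for $1\le p\le2$; in particular $\mathsf{mass}_{a,1}(\mathcal R)=\sum_{R\in\mathcal R}a_R$. $p'=p/(p-1)$. Convention: $\log N$ and $\log\log N$ are understood as $\max\{1,\log N\}$ and $\max\{1,\log\log N\}$. *)

(* Defs.v *)
From HB Require Import structures.
From mathcomp Require Import all_boot all_order all_algebra.
From mathcomp Require Import all_classical all_reals all_analysis.
Set Implicit Arguments.
Unset Strict Implicit.
Unset Printing Implicit Defensive.
Import Order.TTheory GRing.Theory Num.Theory.
Import numFieldNormedType.Exports.
Local Open Scope classical_set_scope.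
Local Open Scope ring_scope.

Definition plane (R : realType) := (measurableTypeR R * measurableTypeR R)%type.

Definition lebesgue2 (R : realType) : {measure set (plane R) -> \bar R} :=
  (@lebesgue_measure R \x @lebesgue_measure R)%E.

(* [lebesgue2] is only meaningful on Borel sets, whereas the union of an
   uncountable family of parallelograms is Lebesgue measurable but need not be
   Borel. The outer measure agrees with the Lebesgue measure on all Lebesgue
   measurable sets. *)
Definition lebesgue2_outer (R : realType) : set (plane R) -> \bar R :=
  ((lebesgue2 R)^*)%mu.

(* The map z |-> A_s z, with A_s = [1 0; s 1]. *)
Definition shear (R : realType) (s : R) (z : plane R) : plane R :=
  (z.1, s * z.1 + z.2).

(* Degenerate intervals are excluded, so that |I|, |J| > 0. *)
Definition bounded_interval (R : realType) (I : set R) : Prop :=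
  [/\ is_interval I, bounded_set I & (0 < lebesgue_measure I)%E].

Definition parallelograms (R : realType) (s : R) : set (set (plane R)) :=
  [set P | exists I J : set R,
    [/\ bounded_interval I, bounded_interval J,
        (lebesgue_measure J <= lebesgue_measure I)%E
      & P = shear s @` (I `*` J)]].

Definition dyadic_interval (R : realType) : set (set R) :=
  [set I | exists j k : int,
    I = `[k%:~R * (2 : R) ^ j, (k + 1)%:~R * (2 : R) ^ j[%classic].

Definition dyadic_rectangles (R : realType) : set (set (plane R)) :=
  [set Q | exists I J : set R,
    [/\ dyadic_interval I, dyadic_interval J,
        (lebesgue_measure J <= lebesgue_measure I)%E & Q = I `*` J]].

Definition dyadic_parallelograms (R : realType) (s : R) : set (set (plane R)) :=
  [set shear s @` Q | Q in @dyadic_rectangles R].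

Definition dyadic_parallelograms_over (R : realType) (S : set R) :
    set (set (plane R)) :=
  \bigcup_(s in S) dyadic_parallelograms s.

Definition shadow (R : realType) (C : set (set (plane R))) : set (plane R) :=
  \bigcup_(Q in C) Q.

Definition area (R : realType) (Q : set (plane R)) : R := fine (lebesgue2 R Q).

Definition average (R : realType) (f : plane R -> R) (Q : set (plane R)) :
    \bar R :=
  (((area Q)^-1)%:E * \int[lebesgue2 R]_(z in Q) (f z)%:E)%E.

(* 0 is added to the supremum only to get 0 for the empty collection; all the
   terms are nonnegative. *)
Definition maximal (R : realType) (C : set (set (plane R))) (f : plane R -> R)
    (z : plane R) : \bar R :=
  maxe 0%E (ereal_sup
    [set (average (fun w => `|f w|%R) Q * (\1_Q z)%:E)%E | Q in C]).

Definition weak_norm (R : realType) (p : R) (g : plane R -> \bar R) : \bar R :=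
  ereal_sup
    [set (l%:E * lebesgue2 R [set z | (l%:E < `|g z|)%E] `^ p^-1)%E
      | l in [set l : R | 0 < l]].

(* Operator norm L^p -> L^{p,oo} of a positively homogeneous operator. *)
Definition weak_type_norm (R : realType) (p : R)
    (M : (plane R -> R) -> plane R -> \bar R) : \bar R :=
  ereal_sup
    [set weak_norm p (M f) | f in
      [set f : plane R -> R | measurable_fun setT f /\
        ('N[lebesgue2 R]_(p%:E)[EFin \o f] <= 1)%E]].

Definition subordinate (R : realType) (L T : set (set (plane R))) : Prop :=
  forall Q, L Q -> exists2 P, T P & Q `<=` P.

(* Only the values of [a] on the dyadic parallelograms over [S] matter. *)
Definition carleson (R : realType) (S : set R) (a : set (plane R) -> R) : Prop :=
  [/\ forall Q, dyadic_parallelograms_over S Q -> 0 <= a Q,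
      (\esum_(Q in dyadic_parallelograms_over S) (a Q)%:E < +oo)%E
    & forall (tau : R) (T L : set (set (plane R))),
        S tau -> T `<=` parallelograms tau ->
        L `<=` dyadic_parallelograms_over S -> subordinate L T ->
        (\esum_(Q in L) (a Q)%:E <= lebesgue2_outer (shadow T))%E].

Definition balayage (R : realType) (a : set (plane R) -> R)
    (C : set (set (plane R))) (z : plane R) : \bar R :=
  (\esum_(Q in C) (a Q * \1_Q z / area Q)%:E)%E.

Definition mass (R : realType) (a : set (plane R) -> R) (p : R)
    (C : set (set (plane R))) : \bar R :=
  'N[lebesgue2 R]_(p%:E)[balayage a C].

Definition log1 (R : realType) (N : nat) : R := Num.max 1 (ln N%:R).

Definition loglog1 (R : realType) (N : nat) : R := Num.max 1 (ln (ln N%:R)).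

(* Main.v *)
(* Expand the square of the balayage. By dyadicity of the bases the [L^2] norm
   is controlled by the averages, over each parallelogram [r], of the part of
   the balayage carried by the [x] whose base lies in that of [r]. Fix the
   slope of [r] and shear it to 0, so that [v] is the vertical coordinate. The
   [x] that are lower than [r] contribute O(1) by the Carleson condition. The
   higher ones see [r] as a point: their contribution is at most
     slice v = |I|^-1 sum (a_x / h_x) 1(v is within O(h_x) of x),
   the sum being over the [x] with base in the base [I] of [r], where [h_x] is
   the vertical extent of [x]. For each fixed [v] this is a one-dimensional
   dyadic average over [I], so integrating the weak (1,1) inequality in [v]
   shows that [slice] exceeds a large constant [k] on a set of measure at most
   a small multiple of the total mass. By the Carleson condition the [x] living
   in that set carry at most half of the mass, and removing all the others
   lowers the averages by at most [k]. Iterating gives a John-Nirenberg type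
   exponential decay, which is summed over the [N] slopes by stopping after
   about [log N] steps. *)

Require Import Defs.
From mathcomp Require Import all_boot all_order all_algebra.
From mathcomp Require Import all_classical all_reals all_analysis.
From mathcomp Require Import measurable_realfun ring lra.
Import Order.TTheory GRing.Theory Num.Theory.
Import numFieldNormedType.Exports.
Set Implicit Arguments.
Unset Strict Implicit.
Unset Printing Implicit Defensive.
Local Open Scope classical_set_scope.
Local Open Scope ring_scope.

(** * Translations, shears and Lebesgue measure on the plane *)

Lemma lebesgue_measure_addl (R : realType) (c : R) (A : set (measurableTypeR R)) :
  measurable A ->
  lebesgue_measure ((fun y : measurableTypeR R => c + y) @^-1` A) = lebesgue_measure A.
Proof.
move=> mA.
have mf : measurable_fun setT
    ((fun y => c + y) : measurableTypeR R -> measurableTypeR R).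
  exact: measurable_funD.
pose nu := measure_function_pushforward__canonical__measure_function_Measure
  (@lebesgue_measure R) mf.
apply/esym; rewrite (lebesgue_measure_unique (mu := nu)) // => _ [[a b] /= _ <-].
rewrite /pushforward.
have -> : (fun y : measurableTypeR R => c + y) @^-1` `]a, b]%classic = `]a - c, b - c]%classic.
  by apply/seteqP; split=> y /=; rewrite !in_itv /= ltrBlDl lerBrDl.
by rewrite !lebesgue_measure_itv /= !lte_fin ltrD2r -!EFinB; case: ifP => // _; congr EFin; ring.
Qed.

Lemma shearK (R : realType) (s : R) : cancel (shear s) (shear (- s)).
Proof. by move=> [u y]; rewrite /shear /=; congr pair; ring. Qed.

Lemma shear_image (R : realType) (s : R) (X : set (plane R)) :
  shear s @` X = shear (- s) @^-1` X.
Proof.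
apply/seteqP; split=> [_ [z Xz <-]|z Xz] /=; first by rewrite shearK.
by exists (shear (- s) z) => //; rewrite -[X in shear X _]opprK shearK.
Qed.

Lemma shear_imageE (R : realType) (s : R) (X : set (plane R)) z :
  (shear s @` X) z <-> X (z.1, z.2 - s * z.1).
Proof. by rewrite shear_image /preimage /shear /= mulNr [- _ + _]addrC. Qed.

Lemma measurable_shear (R : realType) (s : R) :
  measurable_fun setT (shear s : plane R -> plane R).
Proof.
apply: measurable_fun_pair; first exact: measurable_fst.
apply: measurable_funD; last exact: measurable_snd.
by apply: measurable_funM => //; exact: measurable_fst.
Qed.

Lemma measurable_shear_image (R : realType) (s : R) (X : set (plane R)) :
  measurable X -> measurable (shear s @` X).
Proof.
move=> mX; rewrite shear_image -[X in measurable X]setTI.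
exact: measurable_shear.
Qed.

(** By Fubini: a shear translates each vertical section, which preserves its length. *)
Lemma lebesgue2_shear (R : realType) (s : R) (X : set (plane R)) :
  measurable X -> lebesgue2 R (shear s @` X) = lebesgue2 R X.
Proof.
move=> mX; rewrite shear_image; apply: eq_integral => u _ /=.
rewrite -[in RHS](lebesgue_measure_addl (- s * u)); last exact: measurable_xsection.
by congr (lebesgue_measure _); apply/seteqP; split=> y; rewrite /xsection /= !inE.
Qed.

Lemma lebesgue2X (R : realType) (A B : set (measurableTypeR R)) :
  measurable A -> measurable B ->
  lebesgue2 R (A `*` B) = (lebesgue_measure A * lebesgue_measure B)%E.
Proof. exact: product_measure1E. Qed.

Lemma lebesgue2E2 (R : realType) (X : set (plane R)) : measurable X ->
  (lebesgue2 R X = \int[lebesgue_measure]_v lebesgue_measure (ysection X v))%E.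
Proof.
move=> mX; apply: (product_measure_unique
  (m' := product_measure2 (@lebesgue_measure R) (@lebesgue_measure R))) => //.
by move=> A B mA mB /=; exact: product_measure2E.
Qed.

(** The Carleson condition bounds masses by the outer measure of a shadow; a measurable cover turns
    this into a bound by area. *)
Lemma lebesgue2_outer_le (R : realType) (X Y : set (plane R)) :
  measurable Y -> X `<=` Y -> (lebesgue2_outer X <= lebesgue2 R Y)%E.
Proof.
move=> mY XY; rewrite -(measurable_mu_extE _ mY).
exact: le_mu_ext.
Qed.

Lemma lebesgue2_le (R : realType) (X Y : set (plane R)) :
  measurable X -> measurable Y -> X `<=` Y -> (lebesgue2 R X <= lebesgue2 R Y)%E.
Proof. by move=> mX mY XY; apply: le_measure; rewrite ?inE. Qed.

(** * Dyadic maximal inequality and stopping families in one dimension *)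

Section one_dimensional_maximal.
Context {R : realType} {X : finType} (p b m h a : X -> R).
Hypothesis b_gt0 : forall x, 0 < b x.
Hypothesis h_gt0 : forall x, 0 < h x.
Hypothesis a_ge0 : forall x, 0 <= a x.

(** The base of [x] is the interval of length [b x] starting at [p x]; the relation is inclusion of
    bases. *)
Definition base_le x y := (p y <= p x) && (p x + b x <= p y + b y).

Hypothesis base_nested : forall x y,
  [|| base_le x y, base_le y x, p x + b x <= p y | p y + b y <= p x].

(** The factor 8 is 3 + 3 + 2: two elements crossing the same [r] see [q r] within 3 of their
    heights, and the point [u] used in [crossing_sum_stopped] is within 2 heights of the lower
    one. *)
Definition slice (A : {set X}) (z : X) (v : R) : R :=
  (b z)^-1 * \sum_(x in A | base_le x z && (`|v - m x| <= 8 * h x)) a x / h x.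

(** Selects, at height [v], the maximal bases over which [slice] exceeds [k]. Elements with the same
    base have the same slice, so the rank singles out one representative. *)
Definition maximal_slice (A : {set X}) (k : R) (z : X) : set R :=
  [set v | k < slice A z v /\
    forall w, base_le z w -> ~~ (base_le w z && (enum_rank z <= enum_rank w)%N) ->
      slice A w v <= k].

Lemma base_le_refl x : base_le x x.
Proof. by rewrite /base_le !lexx. Qed.

Lemma base_le_trans y x z : base_le x y -> base_le y z -> base_le x z.
Proof. by rewrite /base_le => /andP[? ?] /andP[? ?]; apply/andP; split; lra. Qed.

Lemma base_le_total x y z : base_le x y -> base_le x z ->
  base_le y z || base_le z y.
Proof.
have bx := b_gt0 x.
rewrite {1 2}/base_le => /andP[? ?] /andP[? ?]; move: (base_nested y z).
by case/or4P => [-> //|-> /[!orbT] //|?|?]; exfalso; lra.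
Qed.

(** Take the longest base above that of [z] whose slice exceeds [k], then the least rank among the
    elements with exactly this base. *)
Lemma maximal_slice_exists A k z v : k < slice A z v ->
  exists2 w, base_le z w & maximal_slice A k w v.
Proof.
move=> kz; pose P w := (k < slice A w v) && base_le z w.
have Pz : P z by rewrite /P kz base_le_refl.
case: (@Order.TotalTheory.arg_maxP _ _ _ z P b Pz) => y /andP[ky zy] ymax.
pose Q w := [&& k < slice A w v, base_le y w & base_le w y].
have Qy : Q y by rewrite /Q ky base_le_refl.
case: (@arg_minnP _ y Q (fun w => enum_rank w) Qy) => w /and3P[kw yw wy] wmin.
exists w; first exact: base_le_trans yw.
split=> // w' ww'; apply: contraNT; rewrite -ltNge => kw'.
have yw' := base_le_trans yw ww'.
have w'y : base_le w' y.
  have := ymax w'; rewrite /P kw' (base_le_trans zy yw') => /(_ isT) /=.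
  by move: yw'; rewrite /base_le => /andP[? ?] ?; apply/andP; split; lra.
by rewrite (base_le_trans w'y yw) wmin // /Q kw' yw'.
Qed.

(** Two bases containing that of [x] meet, hence are nested; maximality makes them equal, and the
    rank decides. *)
Lemma maximal_slice_uniq A k x y z v : base_le x y -> base_le x z ->
  maximal_slice A k y v -> maximal_slice A k z v -> y = z.
Proof.
move=> xy xz [ky ymax] [kz zmax].
have base_eq u w : maximal_slice A k u v -> k < slice A w v -> base_le u w ->
    base_le w u && (enum_rank u <= enum_rank w)%N.
  move=> [_ umax] kw uw; apply/negPn/negP => nwu.
  by have := umax w uw nwu; rewrite leNgt kw.
wlog yz : y z xy xz ky ymax kz zmax / base_le y z => [hwlog|].
  have /orP[yz|zy] := base_le_total xy xz; first exact: hwlog.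
  by apply/esym; apply: hwlog zy.
have /andP[zy yz'] := base_eq y z (conj ky ymax) kz yz.
have /andP[_ zy'] := base_eq z y (conj kz zmax) ky zy.
by apply/enum_rank_inj/val_inj/eqP; rewrite eqn_leq yz' zy'.
Qed.

(** Weak (1,1) inequality at a fixed [v]: a selected base has length at most [k^-1] times the weight
    visible from [v] that it contains, and by [maximal_slice_uniq] each [x] is charged to at most
    one selected base. *)
Lemma maximal_slice_sum A k v : 0 < k ->
  \sum_z b z * \1_(maximal_slice A k z) v <=
  k^-1 * \sum_(x in A) a x / h x * \1_[set v | `|v - m x| <= 8 * h x] v.
Proof.
move=> k0; rewrite -(ler_pM2l k0) mulVKf ?gt_eqF // mulr_sumr.
have ah x : 0 <= a x / h x by rewrite divr_ge0 // ltW.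
pose I z := maximal_slice A k z.
apply: (@le_trans _ _ (\sum_z \sum_(x in A | base_le x z)
   (a x / h x * \1_[set v | `|v - m x| <= 8 * h x] v) * \1_(I z) v)).
  apply: ler_sum => z _; rewrite -/(I z) indicE.
  have [|_] := boolP (v \in I z); last by rewrite !mulr0 sumr_ge0 // => x _; rewrite mulr0.
  rewrite inE => -[kz _]; rewrite mulr1 mulrC -ler_pdivlMl //.
  apply: le_trans (ltW kz) _; rewrite /slice ler_pM2l ?invr_gt0 //.
  rewrite [leRHS](bigID (fun x => `|v - m x| <= 8 * h x)) /=.
  rewrite -[leLHS]addr0 lerD //.
    rewrite le_eqVlt; apply/orP; left; apply/eqP.
    apply: eq_big => [x|x /andP[_ /andP[_ vx]]]; first by rewrite andbA.
    by rewrite mulr1 indicE mem_set // mulr1.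
  by rewrite sumr_ge0 // => x _; rewrite mulr1 mulr_ge0.
rewrite (exchange_big_dep (mem A)) /=; last by move=> z x _ /andP[].
apply: ler_sum => x xA; rewrite -mulr_sumr ler_piMr ?(mulr_ge0 (ah x)) //.
have [[z /andP[xz zI]]|nz] := pselect (exists z, base_le x z && (v \in I z)).
  rewrite (bigD1 z) /= ?xA // indicE zI big1 ?addr0 // => w /andP[/andP[_ xw] wz].
  rewrite indicE; case: (boolP (v \in I w)) => // wI; case/eqP: wz.
  by move: wI zI; rewrite !inE => wI zI; exact: maximal_slice_uniq xw xz wI zI.
rewrite big1 // => z /andP[_ xz]; rewrite indicE; case: (boolP (v \in I z)) => // zI.
by case: nz; exists z; rewrite xz.
Qed.

Lemma measurable_slice A z : measurable_fun setT (slice A z : measurableTypeR R -> R).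
Proof.
rewrite (_ : slice A z = fun v => (b z)^-1 * \sum_x
    (if (x \in A) && base_le x z then a x / h x else 0) *
    \1_(`[m x - 8 * h x, m x + 8 * h x]%classic) v); last first.
  apply/funext => v; rewrite /slice; congr (_ * _).
  rewrite big_mkcond; apply: eq_bigr => x _; rewrite andbA.
  case: (_ && base_le x z) => /=; last by rewrite mul0r.
  by rewrite indicE mem_setE in_itv /= ler_distl; case: ifP; rewrite ?mulr1 ?mulr0.
apply: measurable_funM => //; apply: measurable_sum => x.
by apply: measurable_funM => //; apply: measurable_indic; exact: measurable_itv.
Qed.

Lemma measurable_maximal_slice A k z :
  measurable (maximal_slice A k z : set (measurableTypeR R)).
Proof.
have mgt w : measurable ([set v | k < slice A w v] : set (measurableTypeR R)).
  rewrite -[X in measurable X]setTI.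
  rewrite (_ : [set v | _] = slice A w @^-1` `]k, +oo[%classic).
    by apply: measurable_slice => //; exact: measurable_itv.
  by apply/seteqP; split=> v /=; rewrite in_itv /= andbT.
pose P w := base_le z w && ~~ (base_le w z && (enum_rank z <= enum_rank w)%N).
rewrite (_ : maximal_slice _ _ _ = [set v | k < slice A z v] `&`
    \bigcap_(w in [set` P]) ~` [set v | k < slice A w v]).
  apply: measurableI => //; apply: fin_bigcap_measurable; first exact: finite_finpred.
  by move=> w _; apply: measurableC.
apply/seteqP; split=> v [kz zmax]; split => //.
  by move=> w /andP[zw nwz] /=; apply/negP; rewrite -leNgt zmax.
by move=> w zw nwz; rewrite leNgt; apply/negP/(zmax w)/andP.
Qed.

(** Integration in [v]: the window of [x] has length [16 * h x], which cancels the denominator of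
    [a x / h x]. *)
Lemma maximal_slice_measure A k : 0 < k ->
  (\sum_z (b z)%:E * lebesgue_measure (maximal_slice A k z : set (measurableTypeR R)) <=
   (16 / k * \sum_(x in A) a x)%:E)%E.
Proof.
move=> k0.
pose J x : set (measurableTypeR R) := `[m x - 8 * h x, m x + 8 * h x]%classic.
have mJ x : measurable (J x) by exact: measurable_itv.
have muJ x : lebesgue_measure (J x) = (16 * h x)%:E.
  rewrite lebesgue_measure_itv /= lte_fin ifT; last by have := h_gt0 x; lra.
  by rewrite -EFinD; congr EFin; ring.
have mE := measurable_maximal_slice A k.
have ah x : 0 <= a x / h x by rewrite divr_ge0 // ltW.
have bge0 := fun z => ltW (b_gt0 z).
have -> : (\sum_z (b z)%:E * lebesgue_measure (maximal_slice A k z : set (measurableTypeR R)) =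
    \int[lebesgue_measure]_v (\sum_z b z * \1_(maximal_slice A k z) v)%:E)%E.
  under [RHS]eq_integral do rewrite -sumEFin.
  rewrite ge0_integral_sum // => [|z|z v _]; last by rewrite lee_fin mulr_ge0.
    apply: eq_bigr => z _; under eq_integral do rewrite EFinM.
    by rewrite ge0_integralZl ?lee_fin // ?integral_indic ?setIT //; exact/measurable_EFinP.
  by apply/measurable_EFinP/measurable_funM => //; exact: measurable_indic.
pose w x := if x \in A then k^-1 * (a x / h x) else 0.
have w0 x : 0 <= w x by rewrite /w; case: ifP => // _; rewrite mulr_ge0 // invr_ge0 ltW.
have -> : ((16 / k * \sum_(x in A) a x)%:E =
    \int[@lebesgue_measure R]_v (\sum_x w x * \1_(J x) v)%:E)%E.
  under [RHS]eq_integral do rewrite -sumEFin.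
  rewrite ge0_integral_sum // => [|x|x v _]; last by rewrite lee_fin mulr_ge0.
    rewrite mulr_sumr -sumEFin big_mkcond; apply: eq_bigr => x _.
    under eq_integral do rewrite EFinM.
    rewrite ge0_integralZl ?lee_fin //; last exact/measurable_EFinP/measurable_indic.
    rewrite integral_indic // setIT [X in (_ * X)%E]muJ -EFinM /w.
    case: ifP => _; last by rewrite mul0r.
    by congr EFin; field; rewrite (gt_eqF k0) (gt_eqF (h_gt0 x)).
  by apply/measurable_EFinP/measurable_funM => //; exact: measurable_indic.
apply: ge0_le_integral => //.
- by move=> v _; rewrite lee_fin sumr_ge0 // => z _; rewrite mulr_ge0.
- apply/measurable_EFinP/measurable_sum => z; exact: measurable_funM.
- apply/measurable_EFinP/measurable_sum => x; exact: measurable_funM.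
move=> v _; rewrite lee_fin (le_trans (maximal_slice_sum A v k0)) // mulr_sumr.
rewrite big_mkcond le_eqVlt; apply/orP; left; apply/eqP; apply: eq_bigr => x _.
rewrite /w; case: ifP => _; last by rewrite mul0r.
rewrite mulrA; congr (_ * _); rewrite !indicE; congr (nat_of_bool _)%:R.
by apply/idP/idP; rewrite !inE /J /= in_itv /= ler_distl.
Qed.

Context (q c : X -> R).

(** Meant for the elements at least as high as [r] that meet it: points of [x] will lie within
    [2 * h x] of [m x], and the height [c r] adds at most one more [h x], hence the factor 3. *)
Definition crosses x r :=
  [&& base_le x r, c r <= h x & `|q r - m x| <= 3 * h x].

Definition crossing_sum (A : {set X}) (r : X) : R :=
  (b r)^-1 * \sum_(x in A | crosses x r) a x / h x.

(** The elements whose whole vertical range lies where the slice over one containing base exceeds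
    [k]; the radius [2 * h x] is that of [pset_offset]. *)
Definition stopped (A : {set X}) (k : R) : {set X} :=
  [set x in A | `[< exists2 z, base_le x z &
     forall v, `|v - m x| <= 2 * h x -> k < slice A z v >]].

(** Every height in [r] sees the elements crossing [r], since 3 heights plus [c r] stay within 8. A
    large [crossing_sum] thus puts the whole vertical range of [r] where [slice] is large. *)
Lemma crossing_sum_slice A r v : q r <= v <= q r + c r ->
  crossing_sum A r <= slice A r v.
Proof.
move=> /andP[qv vqc]; rewrite /crossing_sum /slice ler_pM2l ?invr_gt0 //.
rewrite big_mkcondr [leRHS]big_mkcondr; apply: ler_sum => x _.
case: ifPn => [/and3P[xr crh qm]|_]; last by case: ifP => // _; rewrite divr_ge0 // ltW.
rewrite xr ifT //=; have := h_gt0 x; move: qm; rewrite !ler_distl.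
by move=> /andP[? ?] ?; apply/andP; split; lra.
Qed.

(* With [x0] of least height [h x0] among the crossing elements outside the
   stopped family, some [u] close to [x0] has [slice A r u <= k], and every
   other crossing element, being higher, still sees [u]. *)
Lemma crossing_sum_stopped A k r : 0 <= k ->
  crossing_sum A r <= k + crossing_sum (stopped A k) r.
Proof.
move=> k0; pose B := A :\: stopped A k.
have -> : crossing_sum A r = crossing_sum B r + crossing_sum (stopped A k) r.
  rewrite /crossing_sum -mulrDr; congr (_ * _).
  rewrite (bigID (mem (stopped A k))) /= addrC; congr (_ + _); apply: eq_bigl => x.
    by rewrite !inE; case: (x \in A); case: (crosses x r); case: (asbool _).
  by rewrite !inE; case: (x \in A); case: (crosses x r); case: (asbool _).
rewrite lerD2r.
case: (pickP [pred x in B | crosses x r]) => [x1 Px1|none]; last first.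
  by rewrite /crossing_sum big_pred0 ?mulr0 // => x; exact: none.
case: (@Order.TotalTheory.arg_minP _ _ _ x1 [pred x in B | crosses x r] h Px1).
move=> x0 /andP[x0B /and3P[x0r crh0 qm0]] hmin.
have [u um0 ku] : exists2 u, `|u - m x0| <= 2 * h x0 & slice A r u <= k.
  move: x0B; rewrite !inE => /andP[nst x0A]; apply: contrapT => nu.
  move: nst; rewrite x0A /= => /asboolPn; apply; exists r => // v vm.
  by rewrite ltNge; apply/negP => vk; apply: nu; exists v.
apply: le_trans ku; rewrite /crossing_sum /slice ler_pM2l ?invr_gt0 //.
rewrite big_mkcond [leRHS]big_mkcond; apply: ler_sum => x _.
case: ifPn => [/andP[xB xr]|_]; last by case: ifP => // _; rewrite divr_ge0 // ltW.
have hx : h x0 <= h x by apply: hmin; rewrite inE xB.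
case/and3P: xr => xr crh qm.
rewrite ifT //; apply/and3P; split=> //; first by move: xB; rewrite inE => /andP[].
move: qm qm0 um0; rewrite !ler_distl => /andP[? ?] /andP[? ?] /andP[? ?].
by apply/andP; split; lra.
Qed.

Context (B : {set X}) (k : R).
Hypothesis k_gt0 : 0 < k.
Hypothesis stopped_half : forall A,
  \sum_(x in stopped A k) a x <= 2^-1 * \sum_(x in A) a x.
Hypothesis crossing_half : forall A,
  \sum_(r in B | k < crossing_sum A r) a r <= 2^-1 * \sum_(x in A) a x.

(** Induction on the size of [A]. Where the crossing sum exceeds [k], its excess is at most [k] plus
    the excess left for [stopped A k]. Each of the two contributions sums to at most [k / 2] times
    the mass of [A]. *)
Lemma crossing_sum_excess0 A :
  \sum_(r in B) a r * Num.max 0 (crossing_sum A r - k) <= k * \sum_(x in A) a x.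
Proof.
have [n] := ubnP #|A|; elim: n A => // n IHn A /ltnSE An.
(* A family equal to its stopped family has at most half of its own mass, hence mass zero; otherwise
   the cardinality drops. *)
have [stA|nstA] := eqVneq (stopped A k) A.
  have mass0 : \sum_(x in A) a x <= 0.
    by have := stopped_half A; rewrite stA; lra.
  rewrite big1 ?mulr_ge0 ?sumr_ge0 ?(ltW k_gt0) // => r _.
  rewrite /crossing_sum big1 ?mulr0.
    by rewrite sub0r max_l ?mulr0 // oppr_le0 ltW.
  move=> x /andP[xA _]; suff -> : a x = 0 by rewrite mul0r.
  apply/eqP; rewrite eq_le a_ge0 andbT (le_trans _ mass0) //.
  by rewrite (bigD1 x) //= lerDl sumr_ge0.
have stA : (#|stopped A k| < n)%N.
  apply: leq_trans An; apply: proper_card; rewrite finset.properEneq nstA /=.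
  by apply/fintype.subsetP => x; rewrite inE => /andP[].
have IH := IHn _ stA.
apply: (@le_trans _ _ (\sum_(r in B | k < crossing_sum A r) a r * k +
    \sum_(r in B) a r * Num.max 0 (crossing_sum (stopped A k) r - k))).
  rewrite big_mkcondr -big_split /=; apply: ler_sum => r _.
  have ar := a_ge0 r; have d := crossing_sum_stopped A r (ltW k_gt0).
  case: ltP => kA; last first.
    by rewrite max_l ?subr_le0 // mulr0 add0r mulr_ge0 // le_max lexx.
  rewrite -mulrDr ler_wpM2l //.
  have : crossing_sum (stopped A k) r - k <= Num.max 0 (crossing_sum (stopped A k) r - k).
    by rewrite le_max lexx orbT.
  set M := Num.max _ _ => ?; rewrite max_r; last by rewrite subr_ge0 ltW.
  by lra.
rewrite -mulr_suml.
have half1 := ler_wpM2r (ltW k_gt0) (crossing_half A).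
have half2 := ler_wpM2l (ltW k_gt0) (stopped_half A).
by rewrite (le_trans (lerD half1 (le_trans IH half2))) //; lra.
Qed.

(** Each passage to the stopped family lowers the threshold by [k] and halves the mass, which gives
    the exponential decay. *)
Lemma crossing_sum_excess n A :
  \sum_(r in B) a r * Num.max 0 (crossing_sum A r - n.+1%:R * k) <=
  2^-1 ^+ n * k * \sum_(x in A) a x.
Proof.
elim: n A => [A|n IHn A]; first by rewrite !mul1r; exact: crossing_sum_excess0.
have c0 : 0 <= 2^-1 ^+ n * k by rewrite mulr_ge0 ?exprn_ge0 // ltW.
apply: le_trans (le_trans (IHn (stopped A k)) _); last first.
  by rewrite (le_trans (ler_wpM2l c0 (stopped_half A))) // exprSr; lra.
apply: ler_sum => r _; rewrite ler_wpM2l // ge_max le_max lexx /= le_max.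
apply/orP; right; have := crossing_sum_stopped A r (ltW k_gt0).
by rewrite [n.+2%:R]mulrS; lra.
Qed.

(** The integer [n] is left free: once [N <= 2 ^ n], the second term summed over [N] slopes costs at
    most [k] times the mass. *)
Lemma crossing_sum_total n A :
  \sum_(r in B) a r * crossing_sum A r <=
  n.+1%:R * k * \sum_(r in B) a r + 2^-1 ^+ n * k * \sum_(x in A) a x.
Proof.
apply: le_trans (lerD (lexx _) (crossing_sum_excess n A)).
rewrite mulr_sumr -big_split /=; apply: ler_sum => r _.
rewrite mulrC -[X in _ <= X + _]mulrC -mulrDr [leLHS]mulrC ler_wpM2l //.
by rewrite -lerBlDl le_max lexx orbT.
Qed.

End one_dimensional_maximal.

(** * Parallelograms: position, rise and intersections *)

Lemma lebesgue2_swap (R : realType) (X : set (plane R)) : measurable X ->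
  lebesgue2 R ((fun z => (z.2, z.1)) @^-1` X : set (plane R)) = lebesgue2 R X.
Proof.
move=> mX; rewrite lebesgue2E2.
  by apply: eq_integral => u _; congr lebesgue_measure; apply/seteqP; split=> v;
    rewrite /ysection /xsection /= !inE.
rewrite -[X in measurable X]setTI; exact: measurable_fun_pair mX.
Qed.

Lemma lebesgue_measure_itv_le (R : realType) (x y : R) (b0 b1 : bool) : x <= y ->
  lebesgue_measure [set` Interval (BSide b0 x) (BSide b1 y)] = (y - x)%:E.
Proof.
move=> xy; rewrite lebesgue_measure_itv /= lte_fin; case: ltP => // yx.
by congr EFin; apply/esym/eqP; rewrite subr_eq0 eq_le xy yx.
Qed.

Record pgram (R : realType) := Pgram {
  slope : R; left : R; width : R; bottom : R; height : R }.

Section pgram_geometry.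
Context {R : realType}.
Implicit Types P Q : pgram R.

Definition pset P : set (plane R) :=
  shear (slope P) @` (`[left P, left P + width P[%classic `*`
                      `[bottom P, bottom P + height P[%classic).

Definition proper_pgram P := [/\ 0 < width P, 0 < height P & height P <= width P].

Lemma psetE P (z : plane R) : pset P z <->
  left P <= z.1 < left P + width P /\
  bottom P <= z.2 - slope P * z.1 < bottom P + height P.
Proof.
by rewrite /pset shear_imageE /= !in_itv.
Qed.

Lemma measurable_pset P : measurable (pset P).
Proof. by apply: measurable_shear_image; apply: measurableX; exact: measurable_itv. Qed.

Lemma lebesgue2_pset P : proper_pgram P ->
  lebesgue2 R (pset P) = (width P * height P)%:E.
Proof.
move=> [w0 h0 _]; rewrite lebesgue2_shear; last by apply: measurableX; exact: measurable_itv.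
rewrite lebesgue2X; [|exact: measurable_itv|exact: measurable_itv].
rewrite !lebesgue_measure_itv_le ?lerDl ?(ltW w0) ?(ltW h0) // -EFinM.
by congr EFin; ring.
Qed.

(* In the coordinate [v = z.2 - s z.1], the points of [P] lie within
   [2 * rise s P] of [offset s P]. *)
Definition offset (s : R) P := bottom P + (slope P - s) * left P.
Definition rise (s : R) P := Num.max (height P) (`|slope P - s| * width P).

Lemma rise_gt0 s P : proper_pgram P -> 0 < rise s P.
Proof. by move=> [_ h0 _]; rewrite lt_max h0. Qed.

Lemma rise_le s P : proper_pgram P -> `|slope P - s| <= 2 -> rise s P <= 2 * width P.
Proof.
move=> [w0 h0 hw] s2; rewrite ge_max ler_wpM2r ?(ltW w0) // andbT; lra.
Qed.

(** Write [z.2 - s * z.1] as [z.2 - slope P * z.1] plus [(slope P - s) * z.1]. On [P] the first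
    varies by at most [height P], the second by the slope difference times [width P]; each is at
    most the rise. *)
Lemma pset_offset s P z : pset P z ->
  offset s P - 2 * rise s P <= z.2 - s * z.1 < offset s P + 2 * rise s P.
Proof.
move=> /psetE[/andP[l1 l2] /andP[b1 b2]].
have hr : height P <= rise s P by rewrite le_max lexx.
have sr : `|slope P - s| * width P <= rise s P by rewrite le_max lexx orbT.
have d : `|(slope P - s) * (z.1 - left P)| <= rise s P.
  by rewrite normrM (le_trans _ sr) // ler_wpM2l // ger0_norm; lra.
move: d; rewrite /offset ler_norml => /andP[d1 d2]; apply/andP; split; lra.
Qed.

(** If the rise is the height, [P] meets the strip of [Q] in area at most [width P * height Q].
    Otherwise two strips of different slopes cross in area [height P * height Q] over the slope
    difference. *)
Lemma pset_inter_le P Q : proper_pgram P -> proper_pgram Q ->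
  (lebesgue2 R (pset P `&` pset Q) <=
   (width P * height P * height Q / rise (slope Q) P)%:E)%E.
Proof.
move=> pP pQ; have [wP0 hP0 hwP] := pP; have [wQ0 hQ0 hwQ] := pQ.
set s := slope Q; set t := slope P - s.
have mI x y : measurable (`[x, y[%classic : set (measurableTypeR R)) by exact: measurable_itv.
have mPQ : measurable (pset P `&` pset Q) by apply: measurableI; exact: measurable_pset.
rewrite /rise -/s -/t; case: (leP (height P) (`|t| * width P)) => ht.
- have t0 : 0 < `|t| by rewrite -(pmulr_lgt0 _ wP0) (lt_le_trans hP0).
  have tn0 : t != 0 by rewrite -normr_gt0.
  (* Exchanging the coordinates and shearing by [t^-1] straightens the strip of [P]: it becomes the
     interval [K'], whose position depends on the sign of [t]. *)
  pose K : set (measurableTypeR R) := `[(- bottom P - height P) / `|t|, - bottom P / `|t|]%classic.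
  have mK : measurable K by exact: measurable_itv.
  pose K' : set (measurableTypeR R) :=
    if 0 < t then K else `[bottom P / `|t|, (bottom P + height P) / `|t|]%classic.
  have mK' : measurable K' by rewrite /K'; case: ifP => // _; exact: measurable_itv.
  pose Y : set (plane R) := `[bottom Q, bottom Q + height Q[%classic `*` K'.
  have mY : measurable Y by exact: measurableX.
  have mS : measurable (shear t^-1 @` Y) by exact: measurable_shear_image.
  pose Z := (fun z => (z.2, z.1)) @^-1` (shear t^-1 @` Y) : set (plane R).
  have mZ : measurable Z.
    rewrite -[X in measurable X]setTI; exact: measurable_fun_pair mS.
  have sub : pset P `&` pset Q `<=` shear s @` Z.
    move=> [u y] [/psetE[/= _ /andP[P1 P2]] /psetE[/= _ /andP[Q1 Q2]]].
    apply/shear_imageE; rewrite /Z; apply/shear_imageE; rewrite /Y /= !in_itv /=.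
    rewrite /= -/s in Q1 Q2 *; split; first by apply/andP; split; lra.
    have Et : `|t| * (u - t^-1 * (y - s * u)) = Num.sg t * (slope P * u - y).
      rewrite [`|t|]normrEsg /t; field; exact: tn0.
    rewrite /K' /K; case: ltP => t00 /=;
      rewrite in_itv /= ler_pdivrMr // ler_pdivlMr // [_ * `|t|]mulrC Et.
      by rewrite gtr0_sg // mul1r; apply/andP; split; lra.
    rewrite ltr0_sg ?lt_neqAle ?tn0 // mulN1r; apply/andP; split; lra.
  apply: le_trans (lebesgue2_le mPQ _ sub) _; first exact: measurable_shear_image.
  rewrite lebesgue2_shear // (lebesgue2_swap mS) lebesgue2_shear // lebesgue2X //.
  rewrite lebesgue_measure_itv_le ?lerDl ?(ltW hQ0) //.
  have -> : lebesgue_measure K' = (height P / `|t|)%:E.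
    rewrite /K' /K; case: ifP => _; (rewrite lebesgue_measure_itv_le;
      [by congr EFin; field; rewrite gt_eqF | by rewrite ler_pM2r ?invr_gt0 //; lra]).
  rewrite -EFinM lee_fin le_eqVlt; apply/orP; left; apply/eqP; field.
  by rewrite !gt_eqF.
have sub : pset P `&` pset Q `<=` shear s @`
    (`[left P, left P + width P[%classic `*` `[bottom Q, bottom Q + height Q[%classic).
  move=> [u y] [/psetE[/= Pu _] /psetE[/= _ /andP[Q1 Q2]]].
  apply/shear_imageE; rewrite /= !in_itv /=; split=> //; rewrite -/s in Q1 Q2.
  by apply/andP; split; lra.
apply: le_trans (lebesgue2_le mPQ _ sub) _.
  by apply: measurable_shear_image; exact: measurableX.
rewrite lebesgue2_shear; last exact: measurableX.
rewrite lebesgue2X // !lebesgue_measure_itv_le ?lerDl ?(ltW hQ0) ?(ltW wP0) // -EFinM lee_fin.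
rewrite le_eqVlt; apply/orP; left; apply/eqP; field.
by rewrite gt_eqF.
Qed.

End pgram_geometry.

Lemma pset_parallelograms (R : realType) (P : pgram R) :
  proper_pgram P -> parallelograms (slope P) (pset P).
Proof.
move=> [w0 h0 hw].
have bi x w : 0 < w -> bounded_interval (`[x, x + w[%classic : set R).
  move=> ww; split; first exact: interval_is_interval.
    exists (`|x| + w); split; first exact: num_real.
    move=> M Mw y /=; rewrite in_itv /= ler_norml => /andP[xy yx].
    have := ler_norm x; have := ler_norm (- x); rewrite normrN => xN xP.
    by apply/andP; split; lra.
  by rewrite lebesgue_measure_itv_le ?lerDl ?(ltW ww) // lte_fin; lra.
exists (`[left P, left P + width P[%classic), (`[bottom P, bottom P + height P[%classic).
split=> //; try exact: bi.
by rewrite !lebesgue_measure_itv_le ?lerDl ?(ltW w0) ?(ltW h0) // lee_fin; lra.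
Qed.

Lemma lebesgue2_bigsetU (R : realType) (X : Type) (F : X -> set (plane R)) (s : seq X) :
  (forall x, measurable (F x)) ->
  (lebesgue2 R (\big[setU/set0]_(x <- s) F x) <= \sum_(x <- s) lebesgue2 R (F x))%E.
Proof.
move=> mF; elim: s => [|x s IHs]; first by rewrite !big_nil measure0.
rewrite !big_cons; apply: le_trans (leeD2l _ IHs).
by apply: measureU2 => //; exact: bigsetU_measurable.
Qed.

(** * Finite families: halving of masses and the energy estimate *)

Section finite_family.
Context {R : realType} {X : finType} (P : X -> pgram R) (a : X -> R).
Hypothesis a_ge0 : forall x, 0 <= a x.
Hypothesis P_proper : forall x, proper_pgram (P x).
Hypothesis slope_le1 : forall x, `|slope (P x)| <= 1.

Local Notation p := (fun x => left (P x)).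
Local Notation b := (fun x => width (P x)).

Hypothesis P_nested : forall x y,
  [|| base_le p b x y, base_le p b y x, p x + b x <= p y | p y + b y <= p x].

Hypothesis P_carleson : forall (z : X) (A : {set X}) (T : X -> pgram R),
  (forall x, x \in A -> [/\ proper_pgram (T x), slope (T x) = slope (P z) &
      pset (P x) `<=` pset (T x)]) ->
  ((\sum_(x in A) a x)%:E <= lebesgue2_outer (\bigcup_(x in [set` A]) pset (T x)))%E.

Section fixed_slope.
Variable y0 : X.

Local Notation s := (slope (P y0)).
Local Notation m := (fun x => offset s (P x)).
Local Notation h := (fun x => rise s (P x)).
Local Notation q := (fun x => bottom (P x)).
Local Notation c := (fun x => height (P x)).
Local Notation slice := (slice p b m h a).
Local Notation maximal_slice := (maximal_slice p b m h a).
Local Notation stopped := (stopped p b m h a).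
Local Notation crossing_sum := (crossing_sum p b m h a q c).

Lemma P_width_gt0 x : 0 < b x. Proof. by case: (P_proper x). Qed.
Lemma P_height_ge0 x : 0 <= c x. Proof. by case: (P_proper x) => _ /ltW. Qed.
Lemma P_rise_gt0 x : 0 < h x. Proof. exact: rise_gt0. Qed.
Lemma P_rise_le x : h x <= 2 * b x.
Proof.
apply: rise_le => //; rewrite (le_trans (ler_normB _ _)) //.
by have := slope_le1 x; have := slope_le1 y0; lra.
Qed.

(** The [T x] are covered by the sets [F w] built on maximal slices at level 256. Bases are dilated
    8 times, so [maximal_slice_measure] bounds the total area by [8 * 16 / 256], that is one half,
    of the mass of [A]. *)
Lemma shadow_half (A C : {set X}) (T : X -> pgram R) :
  (forall x, x \in C -> [/\ proper_pgram (T x), slope (T x) = s,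
      pset (P x) `<=` pset (T x) &
      exists z, [/\ p z <= left (T x), left (T x) + width (T x) <= p z + 8 * b z &
        forall v, bottom (T x) <= v < bottom (T x) + height (T x) ->
          256 < slice A z v]]) ->
  \sum_(x in C) a x <= 2^-1 * \sum_(x in A) a x.
Proof.
move=> CT; rewrite -lee_fin.
pose I z : set (measurableTypeR R) := `[p z, p z + 8 * b z[%classic.
pose E z : set (measurableTypeR R) := maximal_slice A 256 z.
have mI z : measurable (I z) by exact: measurable_itv.
have mE z : measurable (E z) by apply: measurable_maximal_slice.
pose F z : set (plane R) := shear s @` (I z `*` E z).
have mF z : measurable (F z) by apply: measurable_shear_image; exact: measurableX.
have sub : \bigcup_(x in [set` C]) pset (T x) `<=` \big[setU/set0]_z F z.
  move=> [u y] [x /= xC]; have [_ Ts _ [z [zl zr kz]]] := CT x xC.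
  move=> /psetE[/= /andP[u1 u2]]; rewrite Ts => /kz kzy.
  have [w /andP[wl wr] wE] := maximal_slice_exists kzy.
  rewrite -bigcup_seq; exists w; first by rewrite /= mem_index_enum.
  apply/shear_imageE; split=> //=; rewrite /I /= in_itv /=.
  by have := P_width_gt0 z; move=> ?; apply/andP; split; lra.
apply: le_trans (P_carleson (z := y0) (T := T) _) _.
  by move=> x /CT[].
have mU : measurable (\big[setU/set0]_z F z) by exact: bigsetU_measurable.
apply: (le_trans (lebesgue2_outer_le mU sub)).
apply: (le_trans (lebesgue2_bigsetU _ mF)).
have -> : (\sum_z lebesgue2 R (F z) = 8%:E * \sum_z (b z)%:E * lebesgue_measure (E z))%E.
  rewrite ge0_sume_distrr => [|z _]; last by rewrite mule_ge0 ?lee_fin // ltW // P_width_gt0.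
  apply: eq_bigr => z _; rewrite lebesgue2_shear; last exact: measurableX.
  have bz := P_width_gt0 z.
  rewrite lebesgue2X // lebesgue_measure_itv_le; last by lra.
  by rewrite muleA -EFinM; congr (_%:E * _)%E; ring.
have k0 : 0 < 256 :> R by [].
have H := maximal_slice_measure m P_width_gt0 P_rise_gt0 a_ge0 P_nested A k0.
apply: le_trans (lee_wpmul2l _ H) _; first by rewrite lee_fin.
by rewrite -EFinM lee_fin; lra.
Qed.

(** The box covers the vertical range of [P x] in direction [s]. Its width is 8 bases because its
    height [4 * h x] may reach [8 * b x], and a parallelogram must be at least as wide as high. *)
Lemma stopped_half A :
  \sum_(x in stopped A 256) a x <= 2^-1 * \sum_(x in A) a x.
Proof.
apply: (@shadow_half A _ (fun x => Pgram s (p x) (8 * b x) (m x - 2 * h x) (4 * h x))).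
move=> x; rewrite inE => /andP[xA /asboolP[z /andP[zl zr] kz]].
have bx := P_width_gt0 x; have hx := P_rise_gt0 x; have hb := P_rise_le x.
split=> //=; first by split=> /=; lra.
- move=> y Py; have [Py1 _] := (psetE _ _).1 Py.
  have /andP[d1 d2] := pset_offset s Py.
  by apply/psetE; split=> /=; try lra.
- exists z; split=> [||v /andP[v1 v2]] /=; try lra.
  by apply: kz; rewrite ler_distl; apply/andP; split; lra.
Qed.

(** The [P r] have slope [s] and are their own covers: [crossing_sum_slice] puts each of them where
    its slice exceeds 256. *)
Lemma crossing_half (B A : {set X}) : (forall r, r \in B -> slope (P r) = s) ->
  \sum_(r in B | 256 < crossing_sum A r) a r <= 2^-1 * \sum_(x in A) a x.
Proof.
move=> Bs.
rewrite (eq_bigl (mem [set r in B | 256 < crossing_sum A r])); last first.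
  by move=> r; rewrite /= inE.
apply: (@shadow_half A _ P) => r; rewrite inE => /andP[rB kr].
split=> //; first exact: Bs.
exists r; have br := P_width_gt0 r; split=> [||v /andP[v1 v2]]; rewrite ?lexx //; first lra.
apply: lt_le_trans kr _; apply: (crossing_sum_slice p m P_width_gt0 P_rise_gt0 a_ge0).
by rewrite v1 ltW.
Qed.

(** Inner product of the two normalized indicators, a coefficient in the expansion of the squared
    balayage. *)
Definition overlap x y : R :=
  fine (lebesgue2 R (pset (P x) `&` pset (P y))) / ((b x * c x) * (b y * c y)).

Lemma overlap_fin x y :
  (fine (lebesgue2 R (pset (P x) `&` pset (P y))))%:E = lebesgue2 R (pset (P x) `&` pset (P y)).
Proof.
rewrite fineK // ge0_fin_numE //.
apply: (le_lt_trans (lebesgue2_le _ _ (@subIsetl _ _ _))); [|exact: measurable_pset|].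
  by apply: measurableI; exact: measurable_pset.
by rewrite lebesgue2_pset // ltry.
Qed.

Lemma overlap_ge0 x y : 0 <= overlap x y.
Proof.
have := P_width_gt0 x; have := P_width_gt0 y.
by move=> /ltW ? /ltW ?; rewrite divr_ge0 ?fine_ge0 // !mulr_ge0 // P_height_ge0.
Qed.

Lemma overlap_meet x y : overlap x y != 0 -> exists z, (pset (P x) `&` pset (P y)) z.
Proof.
move=> ov; apply: contrapT => nz; move: ov; rewrite /overlap.
rewrite (_ : _ `&` _ = set0) ?measure0 ?mul0r ?eqxx //.
by rewrite -subset0 => w Pw; apply: nz; exists w.
Qed.

Lemma overlap_le_width x y : overlap x y <= (b y * c y)^-1.
Proof.
have [bx cx _] := P_proper x; have [hy cy _] := P_proper y.
rewrite /overlap ler_pdivrMr ?mulr_gt0 // mulrC mulfK ?mulf_neq0 ?gt_eqF //.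
rewrite -lee_fin overlap_fin -(lebesgue2_pset (P_proper x)).
apply: lebesgue2_le; [|exact: measurable_pset|exact: subIsetl].
by apply: measurableI; exact: measurable_pset.
Qed.

Lemma overlap_le_rise x r : slope (P r) = s -> overlap x r <= (b r)^-1 * (h x)^-1.
Proof.
move=> rs; have [bx cx _] := P_proper x; have [br cr _] := P_proper r.
have hx := P_rise_gt0 x.
rewrite /overlap ler_pdivrMr ?mulr_gt0 // -lee_fin overlap_fin.
apply: (le_trans (pset_inter_le (P_proper x) (P_proper r))).
rewrite lee_fin rs le_eqVlt; apply/orP; left; apply/eqP; field.
by rewrite !gt_eqF.
Qed.

(** Such an [x] stays within [4 * h x < 4 * c r] of a point of [r] in the vertical coordinate, so it
    lies in the box [T], and the Carleson condition for this single box gives [9 * 9]. The width is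
    enlarged to keep [T] at least as wide as high. *)
Lemma near_sum r : slope (P r) = s ->
  \sum_(x | [&& base_le p b x r, h x < c r & overlap x r != 0]) a x <= 81 * (b r * c r).
Proof.
move=> rs; have [br cr cbr] := P_proper r.
pose T := Pgram s (p r) (9 * b r) (q r - 4 * c r) (9 * c r).
have pT : proper_pgram T by split=> /=; lra.
pose C := finset (fun x => [&& base_le p b x r, h x < c r & overlap x r != 0]).
rewrite (eq_bigl (mem C)); last by move=> x; rewrite /= inE.
rewrite -lee_fin; apply: (le_trans (P_carleson (z := y0) (T := fun=> T) _)).
  move=> x; rewrite inE => /and3P[/andP[xl xr] hc ov]; split=> // z Pz.
  have [[u y] [Px /psetE[/= _ /andP[Q1 Q2]]]] := overlap_meet ov.
  have /andP[d1 d2] := pset_offset s Px; have /andP[e1 e2] := pset_offset s Pz.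
  have [/andP[z1 z2] _] := (psetE _ _).1 Pz; rewrite rs in Q1 Q2.
  by rewrite /= in d1 d2 e1 e2; apply/psetE; split=> /=; lra.
apply: (le_trans (lebesgue2_outer_le (measurable_pset T) _)).
  by move=> z [x _].
by rewrite lebesgue2_pset // lee_fin /=; lra.
Qed.

(** Elements lower than [r] are handled by the trivial overlap bound and [near_sum]; the others that
    meet [r] cross it, and [overlap_le_rise] turns them into terms of [crossing_sum]. *)
Lemma overlap_sum r : slope (P r) = s ->
  \sum_(x | base_le p b x r) a x * overlap x r <= 81 + crossing_sum [set: X] r.
Proof.
move=> rs; have [br cr cbr] := P_proper r.
apply: (@le_trans _ _ (\sum_(x | [&& base_le p b x r, h x < c r & overlap x r != 0])
    a x * (b r * c r)^-1 + crossing_sum [set: X] r)); last first.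
  rewrite lerD2r -mulr_suml ler_pdivrMr ?mulr_gt0 //; exact: near_sum.
rewrite big_mkcond /crossing_sum mulr_sumr [X in _ <= X + _]big_mkcond /=.
rewrite [X in _ <= _ + X]big_mkcond -big_split /=; apply: ler_sum => x _.
have ax := a_ge0 x; have hx := P_rise_gt0 x.
rewrite ?inE /=; case: ifPn => [xr|_]; last first.
  by rewrite /= add0r; case: ifP => // _; rewrite !mulr_ge0 ?invr_ge0 ?(ltW br) ?(ltW hx).
have [->|ov0] := eqVneq (overlap x r) 0.
  by rewrite mulr0 andbF add0r; case: ifP => // _; rewrite !mulr_ge0 ?invr_ge0 ?(ltW br) ?(ltW hx).
rewrite andbT /=; case: ltP => hc.
  rewrite ler_wpDr //; last by rewrite ler_wpM2l // overlap_le_width.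
  by case: ifP => // _; rewrite !mulr_ge0 ?invr_ge0 ?(ltW br) ?(ltW hx).
rewrite add0r ifT.
  by rewrite [leRHS]mulrCA ler_wpM2l //; exact: overlap_le_rise.
rewrite /crosses xr hc /=.
have [[u y] [Px /psetE[/= _ /andP[Q1 Q2]]]] := overlap_meet ov0.
have /andP[d1 d2] := pset_offset s Px; rewrite rs in Q1 Q2; rewrite /= in d1 d2.
by rewrite ler_distl; apply/andP; split; lra.
Qed.

End fixed_slope.

Lemma overlap_nested x y : overlap x y != 0 -> base_le p b x y || base_le p b y x.
Proof.
move=> /overlap_meet[[u v] [/psetE[/= /andP[? ?] _] /psetE[/= /andP[? ?] _]]].
by have := P_nested x y; rewrite orbA => /orP[//|/orP[] ?]; lra.
Qed.

Lemma overlapC x y : overlap x y = overlap y x.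
Proof. by rewrite /overlap setIC [X in _ / X]mulrC. Qed.

(** A pair with nonzero overlap has nested bases and is charged to the larger one; the two possible
    orders give the factor 2. The resulting sum is split by slope through [t]. *)
Lemma overlap_total (N n : nat) (t : X -> 'I_N) :
  (forall x y, t x = t y -> slope (P x) = slope (P y)) -> (N <= 2 ^ n)%N ->
  \sum_x \sum_y a x * a y * overlap x y <=
  2 * (81 + n.+2%:R * 256) * \sum_x a x.
Proof.
move=> tP Nn.
pose D r := \sum_(x | base_le p b x r) a x * overlap x r.
have main : \sum_r a r * D r <= (81 + n.+2%:R * 256) * \sum_x a x.
  rewrite (partition_big t xpredT) //=.
  apply: (@le_trans _ _ (\sum_(i < N) ((81 + n.+1%:R * 256) * \sum_(r | t r == i) a r +
      2^-1 ^+ n * 256 * \sum_x a x))).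
    apply: ler_sum => i _.
    case: (pickP (fun r => t r == i)) => [y0 /eqP ty0|none]; last first.
      by rewrite !(eq_bigl _ _ none) !big_pred0_eq mulr0 add0r !mulr_ge0 ?exprn_ge0 ?sumr_ge0.
    pose B := finset (fun r => t r == i).
    have Bs r : r \in B -> slope (P r) = slope (P y0).
      by rewrite inE => /eqP tr; apply: tP; rewrite tr ty0.
    have k0 : 0 < 256 :> R by [].
    have := crossing_sum_total P_width_gt0 (P_rise_gt0 y0) a_ge0 k0
      (stopped_half y0) (fun A => @crossing_half y0 B A Bs) n [set: X].
    have Bi : (fun r => r \in B) =1 (fun r => t r == i) by move=> r; rewrite inE.
    have XT : (fun x => x \in [set: X]%SET) =1 xpredT by move=> x; rewrite inE.
    rewrite !(eq_bigl _ _ Bi) (eq_bigl _ _ XT).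
    move=> H; rewrite [leRHS]addrC mulrDl addrCA [X in _ + X]addrC.
    apply: le_trans (lerD (lexx _) H).
    rewrite mulr_sumr -big_split /=; apply: ler_sum => r tr.
    rewrite mulrC [X in _ <= _ + X]mulrC -mulrDl ler_wpM2r //.
    by apply: overlap_sum; apply: Bs; rewrite inE.
  have Ea : \sum_x a x = \sum_(i < N) \sum_(r | t r == i) a r.
    exact: (partition_big t xpredT).
  rewrite big_split /= -mulr_sumr -Ea sumr_const card_ord -mulr_natl.
  have S0 : 0 <= \sum_x a x by rewrite sumr_ge0.
  (* The [N] remainders of [crossing_sum_total] add up to at most 256 times the mass, whence [n.+2]
     instead of [n.+1]. *)
  have N2 : N%:R * 2^-1 ^+ n <= 1 :> R.
    by rewrite exprVn ler_pdivrMr ?exprn_gt0 // mul1r -natrX ler_nat.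
  have := ler_wpM2r S0 N2; rewrite [n.+2%:R]mulrS; lra.
apply: (@le_trans _ _ (\sum_x \sum_y ((if base_le p b x y then a x * a y * overlap x y else 0) +
    (if base_le p b y x then a x * a y * overlap x y else 0)))).
  apply: ler_sum => x _; apply: ler_sum => y _.
  have aov : 0 <= a x * a y * overlap x y.
    by apply: mulr_ge0; [exact: mulr_ge0 | exact: overlap_ge0].
  have [->|/overlap_nested] := eqVneq (overlap x y) 0.
    by rewrite mulr0; do 2 case: ifP => _; rewrite addr0.
  by case: ifP => [_ _|_ /= ->]; rewrite ?lerDl ?lerDr //; case: ifP.
under eq_bigr do rewrite big_split.
rewrite big_split /= exchange_big /=.
have E1 : \sum_j \sum_i (if base_le p b i j then a i * a j * overlap i j else 0) =
    \sum_r a r * D r.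
  apply: eq_bigr => r _; rewrite /D mulr_sumr -big_mkcond; apply: eq_bigr => x _; ring.
have E2 : \sum_j \sum_i (if base_le p b i j then a j * a i * overlap j i else 0) =
    \sum_r a r * D r.
  apply: eq_bigr => r _; rewrite /D mulr_sumr -big_mkcond; apply: eq_bigr => x _.
  by rewrite overlapC; ring.
by rewrite E1 E2; lra.
Qed.

Local Notation c := (fun x => height (P x)).

Definition finite_balayage (z : plane R) : R :=
  \sum_x a x * \1_(pset (P x)) z / (b x * c x).

Lemma integral_finite_balayage :
  (\int[lebesgue2 R]_z (finite_balayage z)%:E = (\sum_x a x)%:E)%E.
Proof.
have bc x : 0 < b x * c x by have [? ? _] := P_proper x; rewrite mulr_gt0.
have mP x : measurable (pset (P x)) by exact: measurable_pset.
under eq_integral do rewrite -sumEFin.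
rewrite ge0_integral_sum // => [|x|x z _]; last first.
- by rewrite lee_fin divr_ge0 ?(ltW (bc x)) // mulr_ge0.
- by apply/measurable_EFinP/measurable_funM => //; exact: measurable_funM.
rewrite -sumEFin; apply: eq_bigr => x _.
under eq_integral do rewrite mulrAC EFinM.
rewrite ge0_integralZl //.
- rewrite integral_indic // setIT [X in (_ * X)%E](lebesgue2_pset (P_proper x)) -EFinM.
  by rewrite divfK // gt_eqF.
- exact/measurable_EFinP.
- by rewrite lee_fin divr_ge0 // (ltW (bc x)).
Qed.

Lemma integral_finite_balayage_sqr :
  (\int[lebesgue2 R]_z (finite_balayage z ^+ 2)%:E =
   (\sum_x \sum_y a x * a y * overlap x y)%:E)%E.
Proof.
have bc x : 0 < b x * c x by have [? ? _] := P_proper x; rewrite mulr_gt0.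
have mPP x y : measurable (pset (P x) `&` pset (P y)).
  by apply: measurableI; exact: measurable_pset.
have E z : (finite_balayage z ^+ 2)%:E = (\sum_x \sum_y
    ((a x * a y / ((b x * c x) * (b y * c y))) * \1_(pset (P x) `&` pset (P y)) z)%:E)%E.
  rewrite expr2 /finite_balayage mulr_suml -sumEFin; apply: eq_bigr => x _.
  rewrite mulr_sumr -sumEFin; apply: eq_bigr => y _; congr EFin.
  have [wx hx _] := P_proper x; have [wy hy _] := P_proper y.
  by rewrite indicI /=; field; rewrite !gt_eqF.
have c0 x y : 0 <= a x * a y / ((b x * c x) * (b y * c y)).
  by apply: divr_ge0; apply: mulr_ge0 => //; exact: ltW.
have mF x y : measurable_fun setT (fun z : plane R =>
    ((a x * a y / ((b x * c x) * (b y * c y))) * \1_(pset (P x) `&` pset (P y)) z)%:E).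
  by apply/measurable_EFinP/measurable_funM.
under eq_integral do rewrite E.
rewrite ge0_integral_sum // => [|x|x z _]; last first.
- by apply: sume_ge0 => y _; rewrite lee_fin mulr_ge0.
- exact: emeasurable_sum.
rewrite -sumEFin; apply: eq_bigr => x _.
rewrite ge0_integral_sum // => [|y z _]; last by rewrite lee_fin mulr_ge0.
rewrite -sumEFin; apply: eq_bigr => y _.
under eq_integral do rewrite EFinM.
rewrite ge0_integralZl ?lee_fin //; last exact/measurable_EFinP.
rewrite integral_indic // setIT -overlap_fin -EFinM /overlap; congr EFin; ring.
Qed.

End finite_family.

(** * Dyadic parallelograms as finite families *)

Definition dyadic_pgram (R : realType) (S : set R) (P : pgram R) : Prop :=
  [/\ S (slope P), proper_pgram P &
      exists k j : int, left P = k%:~R * 2 ^ j /\ width P = 2 ^ j].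

Lemma lebesgue_measure_dyadic (R : realType) (k j : int) :
  lebesgue_measure `[k%:~R * (2 : R) ^ j, (k + 1)%:~R * (2 : R) ^ j[%classic =
  ((2 : R) ^ j)%:E.
Proof.
have j0 : 0 < (2 : R) ^ j by rewrite exprz_gt0.
rewrite lebesgue_measure_itv_le ?ler_pM2r ?ler_int ?lerDl //.
by congr EFin; rewrite intrD; ring.
Qed.

Lemma dyadic_pgram_exists (R : realType) (S : set R) (Q : set (plane R)) :
  dyadic_parallelograms_over S Q -> exists2 P, dyadic_pgram S P & pset P = Q.
Proof.
move=> [s Ss [Q' [I [J [[j [k ->]] [j' [k' ->]]]]]]].
rewrite !lebesgue_measure_dyadic lee_fin => jj' -> <-.
exists (Pgram s (k%:~R * 2 ^ j) (2 ^ j) (k'%:~R * 2 ^ j') (2 ^ j')).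
  by split=> //=; [split; rewrite /= ?exprz_gt0|exists k, j].
by rewrite /pset /= !intrD !mulrDl !mul1r.
Qed.

(** All endpoints are integer multiples of the smaller length [e], so the alternative is decided by
    comparing integers. *)
Lemma dyadic_interval_nested (R : realType) (k j k' j' : int) :
  let x := k%:~R * (2 : R) ^ j in let y := k'%:~R * (2 : R) ^ j' in
  [|| (y <= x) && (x + 2 ^ j <= y + 2 ^ j'), (x <= y) && (y + 2 ^ j' <= x + 2 ^ j),
      x + 2 ^ j <= y | y + 2 ^ j' <= x].
Proof.
wlog jj' : k j k' j' / (j <= j')%R.
  move=> hwlog; have [jj'|/ltW jj'] := leP j j'; first exact: hwlog.
  by have /= := hwlog k' j' k j jj'; case/or4P=> ->; rewrite ?orbT.
have [d ->] : exists d : nat, j' = j + d%:Z.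
  by exists `|j' - j|%N; rewrite gez0_abs ?subr_ge0 // subrKC.
set e := (2 : R) ^ j; have e0 : 0 < e by rewrite exprz_gt0.
have -> : (2 : R) ^ (j + d%:Z) = (2 ^ d%:Z)%:~R * e.
  by rewrite expfzDr // mulrC -exprnP -exprnP rmorphXn.
set D : int := 2 ^ d%:Z.
have step (u v : int) : u <= v -> u%:~R * e <= v%:~R * e by move=> uv; rewrite ler_pM2r // ler_int.
have E (u : int) : u%:~R * e + e = (u + 1)%:~R * e by rewrite intrD mulrDl mul1r.
have E' : k'%:~R * (D%:~R * e) = (k' * D)%:~R * e by rewrite intrM mulrA.
have E'' : (k' * D)%:~R * e + D%:~R * e = (k' * D + D)%:~R * e by rewrite intrD mulrDl.
rewrite /= E' E'' E.
have [kD|Dk] := ltP k (k' * D); first by rewrite [X in [|| _, _, X | _]]step ?orbT // lezD1.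
have [kD'|Dk'] := ltP k (k' * D + D); first by rewrite (step _ _ Dk) (step (k + 1)) // lezD1.
by rewrite [X in [|| _, _, _ | X]]step ?orbT.
Qed.

Lemma countable_dyadic (R : realType) (S : set R) : finite_set S ->
  countable (dyadic_parallelograms_over S).
Proof.
move=> fS; apply: bigcup_countable => [|s _]; first exact: finite_set_countable.
pose F (t : int * int * (int * int)) : set (plane R) := shear s @`
  (`[t.1.2%:~R * (2 : R) ^ t.1.1, (t.1.2 + 1)%:~R * (2 : R) ^ t.1.1[%classic `*`
   `[t.2.2%:~R * (2 : R) ^ t.2.1, (t.2.2 + 1)%:~R * (2 : R) ^ t.2.1[%classic).
apply: (@sub_countable _ _ _ (F @` setT)); last first.
  by apply: (sub_countable (card_image_le _ _)); exact: countableP.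
apply: subset_card_le => Q [_ [I [J [[j [k ->]] [j' [k' ->]] _ ->]]] <-].
by exists ((j, k), (j', k')).
Qed.

(** The sets in [r] are indexed by position and represented by parameters; a numbering of [S]
    supplies the classes [t] of [overlap_total]. *)
Lemma finite_balayage_bounds (R : realType) (N n : nat) (S : set R)
    (a : set (plane R) -> R) (r : seq (set (plane R))) :
  S `<=` `[-1, 1]%classic -> (S #= `I_N)%card -> (N <= 2 ^ n)%N ->
  carleson S a -> uniq r -> {in r, forall Q, dyadic_parallelograms_over S Q} ->
  let g z := \sum_(Q <- r) a Q * \1_Q z / area Q in
  [/\ measurable_fun setT g,
    (\int[lebesgue2 R]_z (g z ^+ 2)%:E <=
      (2 * (81 + n.+2%:R * 256) * \sum_(Q <- r) a Q)%:E)%E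
    & (\int[lebesgue2 R]_z (g z)%:E = (\sum_(Q <- r) a Q)%:E)%E].
Proof.
move=> S1 /card_set_bijP[f fS] Nn [a0 _ acar] ur rS g.
pose X := 'I_(size r); pose Qs (x : X) := nth set0 r x.
have QsS x : dyadic_parallelograms_over S (Qs x) by apply: rS; exact: mem_nth.
have /choice[P PQ] : forall x, exists P, dyadic_pgram S P /\ pset P = Qs x.
  by move=> x; have [P ? ?] := dyadic_pgram_exists (QsS x); exists P.
have Pdy x : dyadic_pgram S (P x) by have [] := PQ x.
have PE x : pset (P x) = Qs x by have [] := PQ x.
pose b x := a (Qs x).
have b0 x : 0 <= b x by exact: a0.
have Pproper x : proper_pgram (P x) by have [] := Pdy x.
have Pslope x : `|slope (P x)| <= 1.
  by have [/S1 + _ _] := Pdy x; rewrite /= in_itv /= ler_norml.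
have Pnested x y : [|| base_le (fun x => left (P x)) (fun x => width (P x)) x y,
    base_le (fun x => left (P x)) (fun x => width (P x)) y x,
    left (P x) + width (P x) <= left (P y) | left (P y) + width (P y) <= left (P x)].
  have [_ _ [k [j [lx wx]]]] := Pdy x; have [_ _ [k' [j' [ly wy]]]] := Pdy y.
  by rewrite /base_le lx wx ly wy; exact: dyadic_interval_nested.
have Pcar (z : X) (A : {set X}) (T : X -> pgram R) :
  (forall x, x \in A -> [/\ proper_pgram (T x), slope (T x) = slope (P z) &
      pset (P x) `<=` pset (T x)]) ->
  ((\sum_(x in A) b x)%:E <= lebesgue2_outer (\bigcup_(x in [set` A]) pset (T x)))%E.
  move=> AT; pose L := Qs @` [set` A].
  have := acar (slope (P z)) [set pset (T x) | x in [set` A]] L.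
  rewrite /shadow bigcup_image => car; apply: le_trans (car _ _ _ _); last first.
  - move=> _ [x /= xA <-]; exists (pset (T x)); first by exists x.
    by rewrite -PE; case: (AT x xA).
  - by move=> _ [x _ <-].
  - move=> _ [x /= xA <-]; have [pT <- _] := AT x xA; exact: pset_parallelograms.
  - by have [] := Pdy z.
  rewrite /L (@reindex_esum _ _ _ [set` A] _ Qs) ?esum_fset //; last first.
  - split=> [x xA|x y _ _ /eqP|_ [x xA <-]]; [by exists x| |by exists x].
    by rewrite /Qs nth_uniq // => /eqP/val_inj.
  - by move=> i _; rewrite lee_fin b0.
  rewrite (_ : [set` A] = [set` enum A]).
    by rewrite -fsbig_seq ?enum_uniq // big_enum /= sumEFin.
  by apply/seteqP; split=> x /=; rewrite mem_enum.
have sumE (F : set (plane R) -> R) : \sum_(Q <- r) F Q = \sum_(x : X) F (Qs x).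
  by rewrite (big_nth set0) big_mkord.
have gE : g = finite_balayage P b.
  apply/funext => z; rewrite /g sumE /finite_balayage; apply: eq_bigr => x _.
  by rewrite /b -PE /area lebesgue2_pset.
split; [|rewrite gE|by rewrite gE integral_finite_balayage // sumE].
  rewrite gE; apply: measurable_sum => x; apply: measurable_funM => //.
  apply: measurable_funM => //; apply: measurable_indic; exact: measurable_pset.
rewrite integral_finite_balayage_sqr // lee_fin sumE.
have fN x : (f (slope (P x)) < N)%N.
  by have [Sx _ _] := Pdy x; case: fS => [fS _ _]; exact: fS.
apply: (overlap_total b0 Pproper Pslope Pnested Pcar (t := fun x => Ordinal (fN x))) => //.
move=> x y [fxy]; have [_ finj _] := fS.
by apply: finj fxy; rewrite inE; [case: (Pdy x)|case: (Pdy y)].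
Qed.

(** * Passage to countable collections *)

Lemma countable_exhaustion (R : realType) (T : choiceType) (D : set T) : countable D ->
  exists r : nat -> seq T, [/\ forall n, uniq (r n), forall n, {in r n, forall x, D x} &
    forall h : T -> \bar R, (forall x, D x -> 0 <= h x)%E ->
      {homo (fun n => \sum_(x <- r n) h x)%E : m n / (m <= n)%N >-> (m <= n)%E} /\
      (\esum_(x in D) h x = limn (fun n => \sum_(x <- r n) h x))%E].
Proof.
move=> /countable_injP[f finj].
(* Truncation by the code [f] is fixed before [h], so one sequence serves the balayage at every
   point. *)
pose F n := D `&` f @^-1` `I_n.
have finF n : finite_set (F n).
  have H : f @` F n `<=` `I_n by move=> _ [x [_ fx] <-].
  have := sub_finite_set H (finite_II n).
  rewrite (eq_finite_set (B := F n)) //; apply: inj_card_eq => x y.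
  by rewrite !inE => -[Dx _] [Dy _]; apply: finj; rewrite inE.
exists (fun n => finmap.enum_fset (fset_set (F n))); split.
- by move=> n; exact: finmap.fset_uniq.
- by move=> n x; rewrite in_fset_set // inE => -[].
move=> h h0.
have sumF n : (\sum_(x <- finmap.enum_fset (fset_set (F n))) h x = \esum_(x in F n) h x)%E.
  by rewrite esum_fset ?fsbig_finite // => x; rewrite inE => -[Dx _]; exact: h0.
have monoF A B : A `<=` B -> (\esum_(x in A) h x <= \esum_(x in B) h x)%E.
  move=> AB; apply: ereal_sup_le => _ [E [finE EA] <-]; exists E => //; split => //.
  exact: subset_trans AB.
have nd : {homo (fun n => \sum_(x <- finmap.enum_fset (fset_set (F n))) h x)%E :
    m n / (m <= n)%N >-> (m <= n)%E}.
  move=> m n mn; rewrite !sumF; apply: monoF => x [Dx fx]; split=> //=.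
  exact: leq_trans fx mn.
split=> //; apply/esym/cvg_lim => //.
rewrite (_ : (\esum_(x in D) h x)%E =
    ereal_sup (range (fun n => \sum_(x <- finmap.enum_fset (fset_set (F n))) h x)%E)).
  exact: ereal_nondecreasing_cvgn.
apply/eqP; rewrite eq_le; apply/andP; split; last first.
  by apply: ge_ereal_sup => _ [n _ <-]; rewrite sumF; apply: monoF => x [].
apply: ge_ereal_sup => _ [E [finE ED] <-].
(* The codes of a finite set are bounded; the successor makes the bound strict. *)
have [n En] : exists n, E `<=` F n.
  have /finite_seqP[s fs] := finite_image f finE.
  exists (\max_(i <- s) i).+1 => x Ex; split; first exact: ED.
  have : f x \in s by have : (f @` E) (f x) by [exists x]; rewrite fs.
  by move=> fxs; rewrite /= ltnS; exact: leq_bigmax_seq.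
apply: (@le_trans _ _ (\esum_(x in F n) h x)%E).
  by rewrite -esum_fset // => [|x]; [exact: monoF|rewrite inE => /ED/h0].
by rewrite -sumF; apply: ereal_sup_ubound; exists n.
Qed.

(** Monotonicity of powers gives one inequality; the other follows from it with the exponent
    [q^-1]. *)
Lemma poweR_limn (R : realType) (u : nat -> \bar R) (q : R) : 0 < q ->
  (forall n, 0 <= u n)%E -> {homo u : m n / (m <= n)%N >-> (m <= n)%E} ->
  ((limn u) `^ q = limn (fun n => u n `^ q))%E.
Proof.
move=> q0 u0 und.
have pmono (r : R) (x y : \bar R) : 0 < r -> (0 <= x)%E -> (x <= y)%E -> (x `^ r <= y `^ r)%E.
  move=> r0 x0 xy; apply: gt0_ler_poweR => //; first exact: ltW.
    by rewrite in_itv /= x0 leey.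
  by rewrite in_itv /= (le_trans x0 xy) leey.
have vnd : {homo (fun n => u n `^ q)%E : m n / (m <= n)%N >-> (m <= n)%E}.
  by move=> m n mn; apply: pmono => //; exact: und.
have cu := ereal_nondecreasing_cvgn und; have cv := ereal_nondecreasing_cvgn vnd.
rewrite (cvg_lim _ cu) // (cvg_lim _ cv) //.
apply/eqP; rewrite eq_le; apply/andP; split; last first.
  by apply: ge_ereal_sup => _ [n _ <-]; apply: pmono => //; apply: ereal_sup_ubound; exists n.
have L0 : (0 <= ereal_sup (range (fun n => u n `^ q)))%E.
  apply: (@le_trans _ _ (u 0%N `^ q)%E); first exact: poweR_ge0.
  by apply: ereal_sup_ubound; exists 0%N.
have S0 : (0 <= ereal_sup (range u))%E.
  by apply: (le_trans (u0 0%N)); apply: ereal_sup_ubound; exists 0%N.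
have qV : q^-1 * q = 1 by rewrite mulVf ?gt_eqF.
have qV' : q * q^-1 = 1 by rewrite mulfV ?gt_eqF.
rewrite -[leRHS]poweRe1 // -qV poweRrM; apply: (pmono q) => //.
apply: ge_ereal_sup => _ [n _ <-].
rewrite -[leLHS]poweRe1 // -qV' poweRrM; apply: pmono; rewrite ?invr_gt0 ?poweR_ge0 //.
by apply: ereal_sup_ubound; exists n.
Qed.

(** For [N] at least 2, take logarithms in [2 ^ (up_log 2 N).-1 < N]. For smaller [N], [up_log]
    vanishes and [log1] is at least 1. *)
Lemma up_log_le_log1 (R : realType) (N : nat) :
  (up_log 2 N).+2%:R <= (3 + (ln 2)^-1) * log1 R N.
Proof.
have l1 : 1 <= log1 R N by rewrite le_max lexx.
have ln2 : 0 < ln 2 :> R by rewrite ln_gt0 // ltr1n.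
have iln2 : 0 <= (ln 2)^-1 :> R by rewrite invr_ge0 ltW.
have [N1|N1] := leqP N 1.
  rewrite (eqP (_ : up_log 2 N == 0%N)) ?up_log_eq0 ?N1 ?orbT //.
  by rewrite (le_trans (_ : _ <= 3 + (ln 2)^-1)) ?ler_peMr //; lra.
have /andP[lo _] := up_log_bounds (isT : 1 < 2)%N N1.
have N0 : 0 < N%:R :> R by rewrite ltr0n ltnW.
have H : (up_log 2 N).-1%:R * ln 2 <= ln N%:R :> R.
  rewrite mulrC mulr_natr -lnXn // ler_ln ?posrE ?exprn_gt0 //.
  by rewrite -natrX ler_nat ltnW.
have L : ln N%:R <= log1 R N by rewrite le_max lexx orbT.
have -> : (up_log 2 N).+2%:R = (up_log 2 N).-1%:R + 3 :> R.
  by rewrite -(natrD _ _ 3) addn3 prednK // up_log_gt0 N1.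
have : (up_log 2 N).-1%:R <= (ln 2)^-1 * log1 R N.
  by rewrite mulrC ler_pdivlMr // (le_trans H).
lra.
Qed.

Theorem theorem3 (R : realType) (gamma A p0 : R) :
  0 <= gamma -> 1 < p0 -> p0 <= 2 ->
  exists C : R,
    forall (N : nat) (S : set R) (Rs : set (set (plane R))),
      S `<=` `[-1, 1]%classic -> (S #= `I_N)%card ->
      Rs `<=` dyadic_parallelograms_over S ->
      (forall p : R, 1 < p -> p <= p0 ->
        (ereal_sup
           [set weak_type_norm p (maximal (Rs `&` dyadic_parallelograms s))
             | s in S]
         <= (A * (p / (p - 1)) `^ gamma)%:E)%E) ->
      forall a : set (plane R) -> R, carleson S a ->
        (mass a 2 Rs <=
           (C * log1 R N `^ (1 / 2)
              * ((1 + gamma) * loglog1 R N) `^ (gamma / 2))%:E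
           * mass a 1 Rs `^ (1 / 2))%E.
Proof.
move=> g0 _ _.
(* With [n = up_log 2 N], the factor [2 * (81 + n.+2 * 256)] is at most [K * log1 R N], by
   [up_log_le_log1] and [1 <= log1 R N]. *)
pose K : R := 2 * (81 + (3 + (ln 2)^-1) * 256).
have ln2 : 0 < ln 2 :> R by rewrite ln_gt0 // ltr1n.
have K0 : 0 <= K by rewrite mulr_ge0 // addr_ge0 // mulr_ge0 // addr_ge0 // invr_ge0 ltW.
exists (K `^ (1 / 2)) => N S Rs S1 SN RsS _ a acar.
have l1 : 1 <= log1 R N by rewrite le_max lexx.
have l0 : 0 <= log1 R N by rewrite (le_trans _ l1).
have fS : finite_set S by exists N.
have a0 Q : Rs Q -> 0 <= a Q by move=> /RsS; case: acar => + _ _; exact.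
have [r [ur rRs rlim]] :=
  countable_exhaustion R (sub_countable (subset_card_le RsS) (countable_dyadic fS)).
have rS n : {in r n, forall Q, dyadic_parallelograms_over S Q} by move=> Q /rRs/RsS.
pose g n z := \sum_(Q <- r n) a Q * \1_Q z / area Q.
have term0 z Q : Rs Q -> 0 <= a Q * \1_Q z / area Q.
  by move=> RQ; rewrite divr_ge0 ?mulr_ge0 ?fine_ge0 // a0.
have gE n z : (g n z)%:E = (\sum_(Q <- r n) (a Q * \1_Q z / area Q)%:E)%E by rewrite sumEFin.
have gn0 n z : 0 <= g n z.
  by rewrite /g big_seq sumr_ge0 // => Q /rRs; exact: term0.
have gnd z : {homo (fun n => (g n z)%:E) : m n / (m <= n)%N >-> (m <= n)%E}.
  move=> m n mn; rewrite !gE.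
  by have [+ _] := rlim (fun Q => (a Q * \1_Q z / area Q)%:E) (term0 z); exact.
have balE z : balayage a Rs z = limn (fun n => (g n z)%:E).
  have [_] := rlim (fun Q => (a Q * \1_Q z / area Q)%:E) (term0 z).
  by rewrite /balayage => ->; rewrite (funext (fun n => gE n z)).
have bal0 z : (0 <= balayage a Rs z)%E.
  by apply: esum_ge0 => Q RQ; rewrite lee_fin term0.
have bounds n := finite_balayage_bounds S1 SN (up_logP N (isT : 1 < 2)%N) acar (ur n) (@rS n).
have mg n : measurable_fun setT (g n) by case: (bounds n).
have mass1 : mass a 1 Rs = limn (fun n => \int[lebesgue2 R]_z (g n z)%:E)%E.
  rewrite /mass Lnorm1; under eq_integral do rewrite gee0_abs // balE.
  apply: monotone_convergence => // [n|n z _]; first exact/measurable_EFinP.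
  by rewrite lee_fin.
have int1_le n : (\int[lebesgue2 R]_z (g n z)%:E <= mass a 1 Rs)%E.
  rewrite mass1 (cvg_lim _ (ereal_nondecreasing_cvgn _)) //.
    by apply: ereal_sup_ubound; exists n.
  move=> i j ij; apply: ge0_le_integral => //.
  - by move=> z _; rewrite lee_fin.
  - exact/measurable_EFinP.
  - exact/measurable_EFinP.
  - by move=> z _; exact: gnd.
(* The bound for finite subfamilies is uniform in [n] and passes to the increasing limit of the
   squares. *)
have int2 : (\int[lebesgue2 R]_z (`|balayage a Rs z| `^ 2) <=
    (K * log1 R N)%:E * mass a 1 Rs)%E.
  have sqrE n z : ((g n z)%:E `^ 2 = (g n z ^+ 2)%:E)%E by rewrite poweR_EFin powR_mulrn.
  under eq_integral => z _.
    rewrite gee0_abs // balE poweR_limn // => [|n]; last by rewrite lee_fin.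
    over.
  rewrite monotone_convergence //; last 3 first.
  - by move=> n; under eq_fun do rewrite sqrE; apply/measurable_EFinP/measurable_funX.
  - by move=> n z _; rewrite poweR_ge0.
  - move=> z _ i j ij; rewrite !sqrE lee_fin ler_sqr ?nnegrE // -lee_fin; exact: gnd.
  apply: lime_le.
    apply: ereal_nondecreasing_is_cvgn => i j ij; apply: ge0_le_integral => //.
    + by move=> z _; rewrite poweR_ge0.
    + by under eq_fun do rewrite sqrE; apply/measurable_EFinP/measurable_funX.
    + by under eq_fun do rewrite sqrE; apply/measurable_EFinP/measurable_funX.
    + by move=> z _; rewrite !sqrE lee_fin ler_sqr ?nnegrE // -lee_fin; exact: gnd.
  apply: nearW => n; under eq_integral do rewrite sqrE.
  have [_ b2 b1] := bounds n; apply: (le_trans b2); rewrite EFinM -b1.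
  apply: lee_pmul => //.
  - by apply: integral_ge0 => z _; rewrite lee_fin; exact: gn0.
  - by rewrite lee_fin; have := up_log_le_log1 R N; rewrite /K; lra.
  - exact: int1_le.
have mass1_ge0 : (0 <= mass a 1 Rs)%E by exact: Lnorm_ge0.
have -> : mass a 2 Rs = ((\int[lebesgue2 R]_z (`|balayage a Rs z| `^ 2)) `^ 2^-1)%E.
  by rewrite /mass unlock.
have I0 : (0 <= \int[lebesgue2 R]_z (`|balayage a Rs z| `^ 2))%E.
  by apply: integral_ge0 => z _; exact: poweR_ge0.
apply: (le_trans (gt0_ler_poweR _ _ _ int2)); rewrite ?invr_ge0 ?in_itv /= ?leey ?andbT ?I0 //.
  by rewrite mule_ge0 // lee_fin mulr_ge0.
have KL0 : (0 <= (K * log1 R N)%:E)%E by rewrite lee_fin mulr_ge0.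
rewrite (poweRM _ KL0 mass1_ge0) (div1r 2).
apply: lee_wpmul2r; first exact: poweR_ge0.
rewrite poweR_EFin lee_fin powRM // ler_peMr ?mulr_ge0 ?powR_ge0 //.
have ll1 : 1 <= loglog1 R N by rewrite le_max lexx.
(* The remaining factor is a power of a number at least 1 with exponent [gamma / 2] nonnegative,
   hence at least 1. *)
have b1 : 1 <= (1 + gamma) * loglog1 R N.
  by rewrite -[leLHS]mul1r ler_pM // lerDl.
by rewrite -[leLHS](powRr0 ((1 + gamma) * loglog1 R N)) ler_powR // divr_ge0.
Qed.
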